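(* There is a randomized algorithm that, given cut-query access to an undirected unweighted graph $G=(V,E)$ on $n$ vertices with two designated terminals $s,t\in V$, computes a minimum $s$-$t$ cut of $G$. The algorithm always makes $\widetilde{O}(n^{8/5})$ cut queries to $G$ and succeeds with high probability.
   Context: Cut-query model: the graph $G$ is hidden; the algorithm may submit any partition $(S,V\setminus S)$ of $V$ to an oracle, which returns the number $|E_G(S,V\setminus S)|$ of edges of $G$ with one endpoint in $S$ and the other in $V\setminus S$. Only the number of queries is counted (local computation is free). An $s$-$t$ cut is a partition $(S,T)$ of $V$ with $s\in S$, $t\in T$; a minimum $s$-$t$ cut minimizes $|E_G(S,T)|$. $\widetilde{O}(\cdot)$ hides polylogarithmic factors in $n$; ''with high probability'' means with probability at least $1-1/\mathrm{poly}(n)$. *)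

(* Defs.v *)
From HB Require Import structures.
From mathcomp Require Import all_boot all_order all_algebra.
From mathcomp Require Import all_classical all_reals all_analysis.

Set Implicit Arguments.
Unset Strict Implicit.
Unset Printing Implicit Defensive.

Import Order.TTheory GRing.Theory Num.Theory.

Local Open Scope ring_scope.

Record sgraph (V : finType) := SGraph {
  adj : rel V;
  adj_sym : symmetric adj;
  adj_irr : irreflexive adj }.

(* An edge with exactly one endpoint in S is counted once, as the ordered pair
   whose first component is the endpoint in S. *)
Definition cut_size (V : finType) (G : sgraph V) (S : {set V}) : nat :=
  #|[set p : V * V | [&& p.1 \in S, p.2 \notin S & adj G p.1 p.2]]|.

(* The cut (S, T) is represented by S, with T = ~: S. *)
Definition is_st_cut (V : finType) (s t : V) (S : {set V}) : bool :=
  (s \in S) && (t \notin S).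

Definition is_min_st_cut (V : finType) (G : sgraph V) (s t : V)
    (S : {set V}) : bool :=
  is_st_cut s t S &&
  [forall S' : {set V}, is_st_cut s t S' ==> (cut_size G S <= cut_size G S')%N].

(* Adaptive randomized cut-query algorithms on a known vertex set V, with
   output in T.  The graph is not an argument: a continuation depends on it
   only through the answers received so far.  [Draw m k] picks an element of
   'I_m.+1 uniformly, independently of all earlier draws, at no cost.  Local
   computation is free, so it is absorbed in the continuations. *)
Inductive cut_algo (V : finType) (T : Type) : Type :=
| Return of T
| Query of {set V} & (nat -> cut_algo V T)
| Draw (m : nat) of ('I_m.+1 -> cut_algo V T).

(* Worst case over all random draws, on the input graph G. *)
Fixpoint max_queries (V : finType) (T : Type) (G : sgraph V)
    (A : cut_algo V T) : nat :=
  match A with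
  | Return _ => 0%N
  | Query X k => (max_queries G (k (cut_size G X))).+1
  | Draw m k => \max_(i < m.+1) max_queries G (k i)
  end.

(* Probability, over the random draws, that the output on G satisfies P. *)
Fixpoint prob_output (R : realType) (V : finType) (T : Type) (G : sgraph V)
    (P : pred T) (A : cut_algo V T) : R :=
  match A with
  | Return x => (P x)%:R
  | Query X k => prob_output R G P (k (cut_size G X))
  | Draw m k => (\sum_(i < m.+1) prob_output R G P (k i)) / m.+1%:R
  end.

(* Main.v *)
(* The algorithm below is deterministic, and makes O(n^(3/2) log n) queries.  It
   keeps a set of known edges and a flow along them, and calls a known edge
   fresh if no augmenting path has used it yet.  With k about sqrt n it
   maintains a partition of V into color classes such that

   - every edge not yet known joins two vertices of the same class;
   - a class P is cut into X and P \ X by at least k fresh edges.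

   If the second condition fails, binary search finds an unknown edge between X
   and P \ X in O(log n) queries, or else one knows that there is none and
   splits P.  When both hold, augmenting along a shortest path of the known
   residual graph costs no query.  If there is no such path, then the reachable
   set S is a minimum cut of G: an unknown edge leaving S would lie in a class P
   cut by S, so a fresh edge, which is residual in both directions, would leave
   S too.

   Counting queries: fresh edges are sparse (at most k(|C|-1) inside any C, as
   an edge is only ever added across a cut of fewer than k fresh edges), so at
   most O(kn) edges are learned beyond those on the augmenting paths.  Let r be
   the flow value still missing and d the distance from s.  Any three consecutive
   distance layers contain at least sqrt r vertices: either an unknown edge
   crosses between them, then they contain a vertex with its k >= sqrt n fresh
   neighbours, or all residual edges of G crossing there are known, and
   there are at least r/2 of them.  Hence a shortest augmenting path has
   at most 3n / sqrt r edges, and all paths together O(n sqrt n). *)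

Require Import Defs.
From HB Require Import structures.
From mathcomp Require Import all_boot all_order all_algebra.
From mathcomp Require Import all_classical all_reals all_analysis.
From mathcomp Require Import fintype finset zify ring lra.

Set Implicit Arguments.
Unset Strict Implicit.
Unset Printing Implicit Defensive.

Import Order.TTheory GRing.Theory Num.Theory.

Local Open Scope nat_scope.

(** * Composition and cost of deterministic query algorithms *)

Fixpoint bind (V : finType) (T U : Type) (A : cut_algo V T)
    (B : T -> cut_algo V U) : cut_algo V U :=
  match A with
  | Return x => B x
  | Query X k => Query X (fun a => bind (k a) B)
  | Draw m k => Draw (fun i => bind (k i) B)
  end.

(* Draws are excluded: the property describes deterministic algorithms. *)
Fixpoint ensures (V : finType) (T : Type) (G : sgraph V) (n : nat)
    (A : cut_algo V T) (Q : T -> Prop) {struct A} : Prop :=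
  match A with
  | Return x => Q x
  | Query X k => if n is n'.+1 then ensures G n' (k (cut_size G X)) Q else False
  | Draw m k => False
  end.

Lemma ensures_weaken (V : finType) (T : Type) (G : sgraph V) (m n : nat)
    (A : cut_algo V T) (Q Q' : T -> Prop) :
  m <= n -> (forall x, Q x -> Q' x) -> ensures G m A Q -> ensures G n A Q'.
Proof.
move=> + QQ'; elim: A m n => [x|X k IH|d k IH] m n //=.
  by move=> _; apply: QQ'.
by case: m => // m; case: n => // n; rewrite ltnS => /IH; apply.
Qed.

Lemma ensures_bind (V : finType) (T U : Type) (G : sgraph V) (m n : nat)
    (A : cut_algo V T) (B : T -> cut_algo V U) (Q : T -> Prop)
    (Q' : U -> Prop) :
  ensures G m A Q -> (forall x, Q x -> ensures G n (B x) Q') ->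
  ensures G (m + n) (bind A B) Q'.
Proof.
move=> + BQ; elim: A m => [x|X k IH|d k IH] m //=.
  by move=> /BQ; apply: ensures_weaken => //; rewrite leq_addl.
by case: m => // m; rewrite addSn; apply: IH.
Qed.

Lemma ensures_max_queries (V : finType) (T : Type) (G : sgraph V) (n : nat)
    (A : cut_algo V T) (Q : T -> Prop) :
  ensures G n A Q -> max_queries G A <= n.
Proof. by elim: A n => [x|X k IH|d k IH] //= [|n] // /IH. Qed.

Lemma ensures_prob_output (R : realType) (V : finType) (T : Type)
    (G : sgraph V) (n : nat) (A : cut_algo V T) (Q : pred T) :
  ensures G n A Q -> prob_output R G Q A = 1%R.
Proof. by elim: A n => [x|X k IH|d k IH] n //=; [move=> -> | case: n => // n /IH]. Qed.

(** * Locating an unknown edge by cut queries *)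

Definition edges_between (V : finType) (G : sgraph V) (A B : {set V}) : nat :=
  #|[set p in setX A B | adj G p.1 p.2]|.

Lemma cut_sizeE (V : finType) (G : sgraph V) (S : {set V}) :
  cut_size G S = edges_between G S (~: S).
Proof.
by apply: eq_card => p; rewrite !inE andbA.
Qed.

Lemma edges_betweenC (V : finType) (G : sgraph V) (A B : {set V}) :
  edges_between G A B = edges_between G B A.
Proof.
rewrite /edges_between -(card_imset _ (can_inj (@swap_pairK V V))).
apply: eq_card => -[u v]; rewrite !inE /=; apply/imsetP/andP => [[[x y]]|].
  by rewrite !inE /= => /andP[/andP[xA yB] xy] [-> ->]; rewrite yB xA adj_sym.
move=> [/andP[uB vA] uv]; exists (v, u) => //.
by rewrite !inE /= vA uB adj_sym.
Qed.

(** An edge between [A] and [B] is cut by each of them but not by their union; every other edge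
    contributes equally to both sides. The proof compares contributions arc by arc. *)
Lemma cut_size_disjointU (V : finType) (G : sgraph V) (A B : {set V}) :
  [disjoint A & B] ->
  cut_size G A + cut_size G B = cut_size G (A :|: B) + (edges_between G A B).*2.
Proof.
move=> /pred0P AB; rewrite -addnn {2}edges_betweenC /edges_between /cut_size.
have cardE (P : pred (V * V)) : #|[set p | P p]| = \sum_p (P p : nat).
  by rewrite -sum1dep_card big_mkcond; apply: eq_bigr => p _; case: (P p).
rewrite !cardE addnA -!big_split /=.
apply: eq_bigr => -[u v] _; rewrite !inE /=.
move: (AB u) (AB v) => /=.
by do ![case: (_ \in _) => //=]; case: (adj _ _ _).
Qed.

Definition has_unknown (V : finType) (G : sgraph V) (K : {set V * V})
    (A B : {set V}) : bool :=
  [exists p in setX A B, adj G p.1 p.2 && (p \notin K)].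

Lemma has_unknownP (V : finType) (G : sgraph V) (K : {set V * V})
    (A B : {set V}) :
  reflect (exists u v, [/\ u \in A, v \in B, adj G u v & (u, v) \notin K])
          (has_unknown G K A B).
Proof.
apply: (iffP existsP) => [[[u v]]|[u [v [uA vB uv uvK]]]].
  by rewrite inE /= => /andP[/andP[uA vB] /andP[uv uvK]]; exists u, v.
by exists (u, v); rewrite inE /= uA vB uv.
Qed.

(** Half of [a + b - c] is the number of edges between [A] and [B]; an unknown one exists exactly
    when this exceeds the number of known ones. *)
Definition query_unknown (V : finType) (K : {set V * V}) (A B : {set V}) :
    cut_algo V bool :=
  Query A (fun a => Query B (fun b => Query (A :|: B) (fun c =>
    Return V (#|K :&: setX A B| < (a + b - c)./2)))).

Lemma query_unknownP (V : finType) (G : sgraph V) (K : {set V * V})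
    (A B : {set V}) :
  (forall u v, (u, v) \in K -> adj G u v) -> [disjoint A & B] ->
  ensures G 3 (query_unknown K A B) (fun b => b = has_unknown G K A B).
Proof.
move=> KG AB; rewrite /query_unknown /= cut_size_disjointU // addKn doubleK.
have sub : K :&: setX A B \subset [set p in setX A B | adj G p.1 p.2].
  by apply/subsetP => -[u v]; rewrite !inE /= => /andP[/KG -> ->].
apply/idP/has_unknownP => [lt|[u [v [uA vB uv uvK]]]].
  have /properP[_ [[u v]]] : K :&: setX A B \proper [set p in setX A B | adj G p.1 p.2].
    by rewrite properEcard sub.
  rewrite !inE /= => /andP[/andP[uA vB] uv]; rewrite uA vB !andbT => uvK.
  by exists u, v.
apply: proper_card; apply/properP; split=> //; exists (u, v).
  by rewrite !inE /= uA vB.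
by rewrite !inE (negbTE uvK).
Qed.

Fixpoint narrow (V : finType) (x0 : V) (d : nat) (K : {set V * V}) (s : seq V)
    (B : {set V}) : cut_algo V V :=
  if d is d'.+1 then
    bind (query_unknown K [set x in take (2 ^ d') s] B) (fun b =>
      if b then narrow x0 d' K (take (2 ^ d') s) B
      else narrow x0 d' K (drop (2 ^ d') s) B)
  else Return V (head x0 s).

(** Binary search: if the first half of [s] has no unknown edge to [B], the second half must have
    one, so one test per level suffices. The default [x0] of [head] is never returned, since [s]
    cannot be empty. *)
Lemma narrowP (V : finType) (G : sgraph V) (x0 : V) (d : nat)
    (K : {set V * V}) (s : seq V) (B : {set V}) :
  (forall u v, (u, v) \in K -> adj G u v) -> size s <= 2 ^ d ->
  [disjoint [set x in s] & B] -> has_unknown G K [set x in s] B ->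
  ensures G (3 * d) (narrow x0 d K s B)
    (fun x => x \in s /\ has_unknown G K [set x] B).
Proof.
move=> KG; elim: d s => [|d IH] s szs dis unk.
  move: szs dis unk; case: s => [|x [|y s]] //=.
    by move=> _ _ /has_unknownP[u [v []]]; rewrite inE.
  move=> _ _ unk; rewrite mem_head; split=> //.
  by move: unk; congr (has_unknown _ _ _ _); apply/setP => z; rewrite !inE.
have disS (s' : seq V) : {subset s' <= s} -> [disjoint [set x in s'] & B].
  move=> ss; apply: disjointWl dis; apply/subsetP => x; rewrite !inE; apply: ss.
have subT : {subset take (2 ^ d) s <= s} by move=> x; apply: mem_take.
have subD : {subset drop (2 ^ d) s <= s} by move=> x; apply: mem_drop.
rewrite mulnS.
rewrite -[narrow _ _ _ _ _]/(bind (query_unknown K [set x in take (2 ^ d) s] B)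
  (fun b => if b then narrow x0 d K (take (2 ^ d) s) B
            else narrow x0 d K (drop (2 ^ d) s) B)).
refine (ensures_bind (query_unknownP KG (disS _ subT)) _) => b ->.
case: ifP => ub.
  apply: ensures_weaken (IH _ _ (disS _ subT) ub) => //.
    by move=> x [/subT].
  by rewrite size_take_min geq_minl.
apply: ensures_weaken (IH _ _ (disS _ subD) _) => //.
- by move=> x [/subD].
- by rewrite size_drop leq_subLR addnn -mul2n -expnS.
have /has_unknownP[u [v [us vB uv uvK]]] := unk.
apply/has_unknownP; exists u, v; split=> //; move: us.
rewrite !inE -{1}(cat_take_drop (2 ^ d) s) mem_cat => /orP[uT|//].
by move/negbT/negP: ub; case; apply/has_unknownP; exists u, v; split; rewrite ?inE.
Qed.

Definition find_unknown (V : finType) (x0 : V) (K : {set V * V})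
    (A B : {set V}) : cut_algo V (option (V * V)) :=
  let d := up_log 2 #|V| in
  bind (query_unknown K A B) (fun b =>
    if b then
      bind (narrow x0 d K (enum A) B) (fun x =>
      bind (narrow x0 d K (enum B) [set x]) (fun y => Return V (Some (x, y))))
    else Return V None).

Definition find_cost (V : finType) : nat := 3 + (3 * up_log 2 #|V|).*2.

Lemma find_unknownP (V : finType) (G : sgraph V) (x0 : V) (K : {set V * V})
    (A B : {set V}) :
  (forall u v, (u, v) \in K -> adj G u v) ->
  (forall u v, (u, v) \in K -> (v, u) \in K) -> [disjoint A & B] ->
  ensures G (find_cost V) (find_unknown x0 K A B) (fun o =>
    if o is Some (u, v)
    then [/\ u \in A, v \in B, adj G u v & (u, v) \notin K]
    else ~~ has_unknown G K A B).
Proof.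
move=> KG KC AB; have enumS (S : {set V}) : [set x in enum S] = S.
  by apply/setP => x; rewrite inE mem_enum.
have szS (S : {set V}) : size (enum S) <= 2 ^ up_log 2 #|V|.
  by rewrite -cardE (leq_trans (max_card _)) // up_logP.
refine (ensures_bind (query_unknownP KG AB) _) => b ->.
case: ifP => [unk|/negbT //].
(* The endpoint in [A] is found first; a second search then looks in [B] for a partner of this
   single vertex. *)
rewrite -addnn; apply: ensures_bind; first by apply: narrowP; rewrite ?enumS.
move=> x [xA ux]; rewrite mem_enum in xA.
rewrite -[X in ensures _ X]addn0; apply: ensures_bind.
  apply: (narrowP _ KG); rewrite ?enumS ?szS //.
    rewrite disjoint_sym disjoints1; apply/negP => xB.
    by move/pred0P: AB => /(_ x) /=; rewrite xA xB.
  move/has_unknownP: ux => [u [v]]; rewrite inE => -[/eqP -> vB xv xvK].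
  apply/has_unknownP; exists v, x; rewrite inE eqxx vB adj_sym; split=> //.
  by apply: contra xvK => /KC.
move=> y [+ /has_unknownP[u [v]]]; rewrite mem_enum !inE.
move=> yB [/eqP -> /eqP -> yx yxK] /=; split=> //; first by rewrite adj_sym.
by apply: contra yxK => /KC.
Qed.

(** * Unit-capacity flows and augmentation *)

Definition antisym_flow (V : finType) (f : {set V * V}) : Prop :=
  forall u v, (u, v) \in f -> (v, u) \notin f.

Definition net_flow (V : finType) (f : {set V * V}) (S : {set V}) : int :=
  (\sum_(a in f) ((a.1 \in S)%:R - (a.2 \in S)%:R))%R.

Lemma net_flowE (V : finType) (f : {set V * V}) (S : {set V}) :
  net_flow f S =
  (#|f :&: setX S (~: S)|%:Z - #|f :&: setX (~: S) S|%:Z)%R.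
Proof.
have cardZ (A : {set V * V}) : (#|A|%:Z = \sum_a (a \in A)%:R)%R.
  rewrite -sum1_card -natz natr_sum big_mkcond /=.
  by apply: eq_bigr => a _; case: (a \in A).
rewrite !cardZ -sumrB /net_flow big_mkcond /=; apply: eq_bigr => -[u v] _.
rewrite !inE /=; do 3![case: (_ \in _)] => //=; lia.
Qed.

Lemma net_flow_le (V : finType) (G : sgraph V) (f : {set V * V})
    (S : {set V}) :
  (forall u v, (u, v) \in f -> adj G u v) ->
  (net_flow f S <= (cut_size G S)%:Z)%R.
Proof.
move=> fG; rewrite net_flowE cut_sizeE.
suff: #|f :&: setX S (~: S)| <= edges_between G S (~: S) by lia.
apply/subset_leq_card/subsetP => -[u v].
by rewrite !inE /= => /andP[/fG -> ->].
Qed.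

(** The excess counts the outgoing arcs without flow, plus the incoming arcs with flow. Reversing
    one of the latter gives, by antisymmetry, an outgoing arc without flow, whence the factor 2. *)
Lemma cut_excess_le (V : finType) (G : sgraph V) (f : {set V * V})
    (S : {set V}) :
  (forall u v, (u, v) \in f -> adj G u v) -> antisym_flow f ->
  ((cut_size G S)%:Z - net_flow f S <=
   (#|[set a in setX S (~: S) | adj G a.1 a.2 && (a \notin f)]|.*2)%:Z)%R.
Proof.
move=> fG fA; rewrite net_flowE cut_sizeE /edges_between.
set E := [set p in _ | _]; set U := [set a in _ | _].
have EU : #|E| = #|f :&: setX S (~: S)| + #|U|.
  rewrite -(cardsID f E); congr (_ + _); apply: eq_card => -[u v].
    rewrite !inE /=; case uvf: ((u, v) \in f); rewrite ?andbF //=.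
    by rewrite (fG _ _ uvf) !andbT.
  by rewrite !inE /= andbC andbA.
have : #|f :&: setX (~: S) S| <= #|U|.
  rewrite -(card_imset (mem (f :&: _)) (can_inj (@swap_pairK V V))).
  apply/subset_leq_card/subsetP => _ /imsetP[[u v] + ->].
  rewrite !inE /= => /and3P[uvf uS vS]; rewrite vS uS /=.
  by rewrite adj_sym (fG _ _ uvf) fA.
by rewrite EU; lia.
Qed.

Definition push (V : finType) (f : {set V * V}) (a : V * V) : {set V * V} :=
  if swap_pair a \in f then f :\ swap_pair a else a |: f.

(* The net flow out of every set is tracked instead of flow conservation at the
   vertices: pushing one unit along an arc changes it by the same amount whether
   or not it cancels flow on the reverse arc. *)
Lemma net_flow_push (V : finType) (f : {set V * V}) (x y : V) (S : {set V}) :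
  (x, y) \notin f ->
  (net_flow (push f (x, y)) S =
   net_flow f S + (x \in S)%:R - (y \in S)%:R)%R.
Proof.
rewrite /push /net_flow /swap_pair /= => xyf; case: ifP => yxf.
  by rewrite [in RHS](big_setD1 _ yxf) /=; ring.
by rewrite big_setU1 //=; ring.
Qed.

Lemma push_sub (V : finType) (f : {set V * V}) (a b : V * V) :
  b \in push f a -> b \in f \/ b = a.
Proof.
rewrite /push; case: ifP => _; rewrite !inE.
  by case/andP; left.
by case/orP => [/eqP|]; [right | left].
Qed.

Lemma push_antisym (V : finType) (f : {set V * V}) (x y : V) :
  x != y -> antisym_flow f -> antisym_flow (push f (x, y)).
Proof.
move=> xy fA u v; rewrite /push /swap_pair /=; case: ifP => yxf; rewrite !inE.
  by case/andP => _ /fA vu; rewrite (negbTE vu) andbF.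
case/orP => [/eqP[-> ->]|uvf].
  by rewrite yxf orbF xpair_eqE eq_sym (negbTE xy).
rewrite (negbTE (fA _ _ uvf)) orbF; apply/eqP => -[vx uy].
by rewrite -vx -uy uvf in yxf.
Qed.

Fixpoint push_path (V : finType) (f : {set V * V}) (x : V) (p : seq V) :
    {set V * V} :=
  if p is y :: q then push_path (push f (x, y)) y q else f.

Lemma push_pathP (V : finType) (f : {set V * V}) (x : V) (p : seq V) :
  uniq (x :: p) -> path (fun u v => (u, v) \notin f) x p -> antisym_flow f ->
  [/\ antisym_flow (push_path f x p),
      forall S : {set V}, (net_flow (push_path f x p) S =
        net_flow f S + (x \in S)%:R - (last x p \in S)%:R)%R &
      forall a, a \in push_path f x p -> a \in f \/ a \in zip (x :: p) p].
Proof.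
elim: p f x => [|y q IH] f x.
  by move=> _ _ fA; split=> //= [S|a]; [ring | left].
move=> /= /andP[xq uq] /andP[xyf pq] fA.
have xy : x != y by move: xq; rewrite inE negb_or => /andP[].
(* The first push can only add an arc leaving [x], and the rest of a simple path never leaves from
   [x]. *)
have pq' : path (fun u v => (u, v) \notin push f (x, y)) y q.
  apply: (sub_in_path (P := [pred z | z != x])) pq => [u v|].
    rewrite !inE => ux _; apply: contra => /push_sub[//|[ux' _]].
    by rewrite ux' eqxx in ux.
  by apply/allP => z zq; rewrite inE; apply: contraNneq xq => <-.
have [A N B] := IH _ _ uq pq' (push_antisym xy fA); split=> // [S|a].
  by rewrite N net_flow_push //; ring.
move=> /B[/push_sub[|->]|aq]; [by left | right; exact: mem_head | right].
by rewrite inE aq orbT.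
Qed.

(** * Shortest paths and distance layers *)

Definition shortest (V : finType) (e : rel V) (s t : V) (p : seq V) : Prop :=
  [/\ path e s p, last s p = t, uniq (s :: p) &
      forall q, path e s q -> last s q = t -> size p <= size q].

Lemma connect_shortest (V : finType) (e : rel V) (s t : V) :
  connect e s t -> exists p, shortest e s t p.
Proof.
case/connectP => p0 p0p p0t.
pose P n := `[< exists p, [/\ path e s p, last s p = t & size p = n] >].
have exP : exists n, P n by exists (size p0); apply/asboolP; exists p0.
case: (ex_minnP exP) => n /asboolP[p [pp pt <-]] nmin.
case: (shortenP pp) pt => q pq uq sub qt; 
have qp := uniq_leq_size (subseq_uniq (subseq_cons q s) uq) sub; exists q; split=> //.
move=> r rp rt; apply: leq_trans qp _; apply: nmin.
by apply/asboolP; exists r.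
Qed.

(** The potential is the distance from [s] truncated at [size p]; truncation gives unreachable
    vertices a value as well. *)
Lemma exists_potential (V : finType) (e : rel V) (s t : V) (p : seq V) :
  shortest e s t p ->
  exists d : V -> nat, [/\ d s = 0, size p <= d t &
    forall u v, e u v -> d v <= (d u).+1].
Proof.
case=> _ _ _ pmin.
pose P v n := `[< size p <= n \/
  exists q, [/\ path e s q, last s q = v & size q <= n] >].
have exP v : exists n, P v n by exists (size p); apply/asboolP; left.
exists (fun v => ex_minn (exP v)); split.
- case: ex_minnP => n _ /(_ 0); rewrite leqn0 => nmin; apply/eqP/nmin.
  by apply/asboolP; right; exists [::].
- by case: ex_minnP => n /asboolP[//|[q [qp /(pmin _ qp) pq qn]]] _; apply: leq_trans qn.
move=> u v uv; case: (ex_minnP (exP u)) => n /asboolP Pn _.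
case: ex_minnP => m _; apply; apply/asboolP.
case: Pn => [pn|[q [qp qu qn]]]; first by left; apply: leqW.
right; exists (rcons q v).
by rewrite rcons_path qp qu uv last_rcons size_rcons.
Qed.

(** These are the layers [i - 1], [i] and [i + 1], written without a predecessor so that [i = 0] is
    no special case. *)
Definition window (V : finType) (d : V -> nat) (i : nat) : {set V} :=
  [set v | (i <= (d v).+1) && (d v <= i.+1)].

Lemma sum_window (V : finType) (d : V -> nat) (D : nat) :
  \sum_(i < D) #|window d i| <= 3 * #|V|.
Proof.
have -> : \sum_(i < D) #|window d i| =
    \sum_v \sum_(i < D) ((i <= (d v).+1) && (d v <= i.+1) : nat).
  rewrite exchange_big; apply: eq_bigr => i _.
  rewrite -sum1dep_card big_mkcond; apply: eq_bigr => v _.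
  by case: (_ && _).
rewrite mulnC -sum_nat_const; apply: leq_sum => v _.
have -> : \sum_(i < D) ((i <= (d v).+1) && (d v <= i.+1) : nat) =
    size [seq i <- iota 0 D | (i <= (d v).+1) && (d v <= i.+1)].
  rewrite size_filter -sum1_count [RHS]big_mkcond.
  by rewrite -[X in iota 0 X](subn0 D) -/(index_iota 0 D) big_mkord; apply: eq_bigr => i _; case: (_ && _).
apply: (@uniq_leq_size _ _ [:: (d v).-1; d v; (d v).+1]).
  by rewrite filter_uniq ?iota_uniq.
move=> i; rewrite mem_filter !inE => /andP[/andP[]]; lia.
Qed.

(** * States of the algorithm and their invariant *)

(* All edge sets are sets of arcs; [known] and [touched] are symmetric, [flow] is
   antisymmetric.  [touched] holds the edges that some augmenting path has used. *)
Record state (V : finType) := State {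
  known : {set V * V};
  touched : {set V * V};
  flow : {set V * V};
  color : V -> nat;
  ncolors : nat }.

Definition fresh (V : finType) (st : state V) : {set V * V} :=
  known st :\: touched st.

Definition color_class (V : finType) (st : state V) (x : V) : {set V} :=
  [set v | color st v == color st x].

(** Because equal colors are required, splitting a class can only shrink this set; the lost arcs
    pass to [fresh_across]. *)
Definition fresh_within (V : finType) (st : state V) (C : {set V}) :
    {set V * V} :=
  [set a in fresh st | [&& a.1 \in C, a.2 \in C & color st a.1 == color st a.2]].

Definition fresh_across (V : finType) (st : state V) : {set V * V} :=
  [set a in fresh st | color st a.1 != color st a.2].

Definition residual (V : finType) (st : state V) : rel V :=
  fun u v => ((u, v) \in known st) && ((u, v) \notin flow st).

(** The vertex [x] names the class and makes [X] nonempty. *)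
Definition deficient (V : finType) (k : nat) (st : state V) (x : V)
    (X : {set V}) : bool :=
  [&& x \in X, X \proper color_class st x &
      #|fresh st :&: setX X (color_class st x :\: X)| < k].

Definition add_edge (V : finType) (st : state V) (u v : V) : state V :=
  State ((u, v) |: ((v, u) |: known st)) (touched st) (flow st)
        (color st) (ncolors st).

Definition split_color (V : finType) (st : state V) (X : {set V}) : state V :=
  State (known st) (touched st) (flow st)
        (fun v => if v \in X then ncolors st else color st v) (ncolors st).+1.

Definition augment (V : finType) (st : state V) (s : V) (p : seq V) : state V :=
  let arcs := zip (s :: p) p in
  State (known st)
        (touched st :|: [set a in arcs] :|: [set a in map swap_pair arcs])
        (push_path (flow st) s p) (color st) (ncolors st).

(** [flow_value] expresses conservation and value together: all s-t cuts carry the same net flow.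
    The factors 2 count each edge as two arcs. [color_surj] bounds the number of colors by [#|V|].
    The parameter [c0] stands for the minimum cut size. *)
Record state_invariant (R : realType) (V : finType) (G : sgraph V) (s t : V)
    (k c0 val : nat) (st : state V) : Prop := Invariant {
  known_adj : forall u v, (u, v) \in known st -> adj G u v;
  known_sym : forall u v, (u, v) \in known st -> (v, u) \in known st;
  touched_known : forall u v, (u, v) \in touched st -> (u, v) \in known st;
  touched_sym : forall u v, (u, v) \in touched st -> (v, u) \in touched st;
  flow_touched : forall u v, (u, v) \in flow st -> (u, v) \in touched st;
  flow_antisym : antisym_flow (flow st);
  unknown_mono : forall u v, adj G u v -> (u, v) \notin known st ->
    color st u = color st v;
  color_lt : forall v, color st v < ncolors st;
  color_surj : forall i, i < ncolors st -> exists v, color st v = i;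
  fresh_within_le : forall C : {set V}, C != set0 ->
    #|fresh_within st C| <= 2 * k * #|C|.-1;
  fresh_across_le : #|fresh_across st| <= 2 * k * ncolors st;
  flow_value : forall S, is_st_cut s t S -> net_flow (flow st) S = val%:Z%R;
  (* Sum over the missing values r of twice the path length 3n / sqrt r, using
     1 / sqrt r <= 2 (sqrt r - sqrt (r - 1)). *)
  touched_le : (#|touched st|%:R <=
    12 * #|V|%:R * (Num.sqrt c0%:R - Num.sqrt (c0 - val)%:R) :> R)%R }.

Lemma fresh_sym (R : realType) (V : finType) (G : sgraph V) (s t : V)
    (k c0 val : nat) (st : state V) :
  state_invariant R G s t k c0 val st ->
  forall u v, (u, v) \in fresh st -> (v, u) \in fresh st.
Proof.
move=> I u v; rewrite !inE => /andP[uvT /(known_sym I) ->]; rewrite andbT.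
by apply: contra uvT => /(touched_sym I).
Qed.

Lemma cardsU_le (T : finType) (A B : {set T}) : #|A :|: B| <= #|A| + #|B|.
Proof. exact: leq_card_setU. Qed.

Lemma card_swapI (V : finType) (F : {set V * V}) (A B : {set V}) :
  (forall u v, (u, v) \in F -> (v, u) \in F) ->
  #|F :&: setX B A| = #|F :&: setX A B|.
Proof.
move=> FC; rewrite -(card_imset (mem (F :&: setX A B)) (can_inj (@swap_pairK V V))).
apply: eq_card => -[u v]; apply/idP/imsetP.
  rewrite !inE /= => /and3P[/FC vuF uB vA]; exists (v, u) => //.
  by rewrite !inE /= vuF vA.
by move=> [[x y]]; rewrite !inE /= => /and3P[/FC yx xA yB] [-> ->]; rewrite yx yB.
Qed.

(** * The invariant at the start, after learning an edge and after a split *)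

Lemma init_invariant (R : realType) (V : finType) (G : sgraph V) (s t : V)
    (k c0 : nat) :
  state_invariant R G s t k c0 0 (State set0 set0 set0 (fun=> 0) 1).
Proof.
split=> //=; try by move=> u v; rewrite inE.
- by case=> // _; exists s.
- move=> C _; rewrite [fresh_within _ _](_ : _ = set0) ?cards0 //.
  by apply/setP => a; rewrite !inE.
- rewrite [fresh_across _](_ : _ = set0) ?cards0 //.
  by apply/setP => a; rewrite !inE.
- by move=> S _; rewrite /net_flow big_set0.
- by rewrite cards0 subn0 subrr mulr0.
Qed.

Lemma add_edge_invariant (R : realType) (V : finType) (G : sgraph V) (s t : V)
    (k c0 val : nat) (st : state V) (x u v : V) (X : {set V}) :
  state_invariant R G s t k c0 val st -> deficient k st x X ->
  u \in X -> v \in color_class st x :\: X -> adj G u v ->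
  (u, v) \notin known st ->
  state_invariant R G s t k c0 val (add_edge st u v) /\
  #|known st| < #|known (add_edge st u v)|.
Proof.
move=> I /and3P[xX /properP[/subsetP sX _] small] uX.
rewrite !inE => /andP[vX /eqP vc] uv uvK.
have uc : color st u = color st x by have := sX _ uX; rewrite inE => /eqP.
split; last first.
  apply: proper_card; apply/properP; split.
    by apply/subsetP => a; rewrite !inE => ->; rewrite !orbT.
  by exists (u, v); rewrite // !inE eqxx.
split=> //=; try by case: I.
- move=> a b; rewrite !inE => /or3P[/eqP[-> ->]//|/eqP[-> ->]|/(known_adj I)//].
  by rewrite adj_sym.
- move=> a b; rewrite !inE => /or3P[/eqP[-> ->]|/eqP[-> ->]|/(known_sym I) ->].
  + by rewrite eqxx orbT.
  + by rewrite eqxx.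
  + by rewrite !orbT.
- by move=> a b /(touched_known I); rewrite !inE => ->; rewrite !orbT.
- move=> a b ab; rewrite !inE !negb_or => /and3P[_ _]; exact: (unknown_mono I).
- move=> C C0; set st' := add_edge st u v.
  have newF a : a \in fresh st' -> [\/ a = (u, v), a = (v, u) | a \in fresh st].
    rewrite !inE => /andP[aT /or3P[/eqP|/eqP|aK]]; [exact: Or31|exact: Or32|].
    by apply: Or33; rewrite aT.
  have [/andP[uC vC]|nC] := boolP ((u \in C) && (v \in C)); last first.
    apply: leq_trans (fresh_within_le I C0); apply/subset_leq_card/subsetP => a.
    rewrite inE => /andP[/newF aF /and3P[a1 a2 ac]]; rewrite inE.
    rewrite a1 a2 ac andbT; case: aF => aE; move: nC; last by rewrite aE.
      by rewrite -[u]/(u, v).1 -aE a1 -[v in v \in C]/(u, v).2 -aE a2.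
    by rewrite -[u in u \in C]/(v, u).2 -aE a2 -[v]/(v, u).1 -aE a1.
  (* Now [C] contains both ends. The set [X] cuts it into two nonempty parts, each bounded by
     hypothesis, and at most [k] fresh arcs cross in either direction, the new one included. The sum
     is [2k(|C :&: X| - 1) + 2k(|C :\: X| - 1) + 2k = 2k(|C| - 1)]. *)
  pose Y := color_class st x :\: X.
  have AC : #|C :&: X| + #|C :\: X| = #|C| := cardsID X C.
  have A0 : C :&: X != set0 by apply/set0Pn; exists u; rewrite inE uC.
  have B0 : C :\: X != set0 by apply/set0Pn; exists v; rewrite inE vX.
  have sub : fresh_within st' C \subset
      fresh_within st (C :&: X) :|: fresh_within st (C :\: X) :|:
      ((u, v) |: (fresh st :&: setX X Y)) :|:
      ((v, u) |: (fresh st :&: setX Y X)).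
    apply/subsetP => -[a b]; rewrite inE => /andP[/newF aF /= /and3P[aC bC ab]].
    rewrite !(inE, in_setU, in_set1).
    case: aF => [->|->|aF]; rewrite ?eqxx ?orbT //; move: aF.
    rewrite !inE => /andP[-> ->]; rewrite /= aC bC ab !andbT /=.
    case aX: (a \in X); case bX: (b \in X); rewrite /= ?andbF ?andbT ?orbT //=.
      by rewrite -(eqP ab) (eqP (_ : color st a == color st x)) ?eqxx ?orbT //;
        have := sX _ aX; rewrite inE.
    by rewrite (eqP ab) (eqP (_ : color st b == color st x)) ?eqxx ?orbT //;
      have := sX _ bX; rewrite inE.
  have c1 : #|(u, v) |: (fresh st :&: setX X Y)| <= k.
    by rewrite cardsU1; apply: leq_trans small; rewrite -add1n leq_add2r leq_b1.
  have c2 : #|(v, u) |: (fresh st :&: setX Y X)| <= k.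
    rewrite cardsU1 (card_swapI _ _ (fresh_sym I)).
    by apply: leq_trans small; rewrite -add1n leq_add2r leq_b1.
  have a0 : 0 < #|C :&: X| by rewrite card_gt0.
  have b0 : 0 < #|C :\: X| by rewrite card_gt0.
  have -> : #|C|.-1 = #|C :&: X|.-1 + #|C :\: X|.-1 + 1 
    by rewrite -AC -{1}(prednK a0) -{1}(prednK b0) addSn addnS addn1.
  rewrite !mulnDr muln1 mul2n -[X in _ <= _ + X]addnn addnA.
  apply: leq_trans (subset_leq_card sub) _; 
  apply: leq_trans (cardsU_le _ _) _; apply: leq_add c2.
  apply: leq_trans (cardsU_le _ _) _; apply: leq_add c1.
  apply: leq_trans (cardsU_le _ _) _; rewrite -mul2n.
  by apply: leq_add; exact: (fresh_within_le I).
- apply: leq_trans (fresh_across_le I); apply/subset_leq_card/subsetP => a.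
  rewrite inE => /andP[+ ac]; rewrite !inE ac andbT.
  case/andP => -> /or3P[/eqP aE|/eqP aE|-> //].
    by move: ac; rewrite aE /= uc vc eqxx.
  by move: ac; rewrite aE /= uc vc eqxx.
Qed.

(** No unknown edge leaves [X], so recoloring it separates no unknown edge. Fewer than [k] fresh
    arcs in each direction become bichromatic, and the new color pays for these. *)
Lemma split_color_invariant (R : realType) (V : finType) (G : sgraph V)
    (s t : V) (k c0 val : nat) (st : state V) (x : V) (X : {set V}) :
  state_invariant R G s t k c0 val st -> deficient k st x X ->
  ~~ has_unknown G (known st) X (color_class st x :\: X) ->
  state_invariant R G s t k c0 val (split_color st X).
Proof.
move=> I /and3P[xX /properP[/subsetP sX [y yc yX]] small] unk.
have Xc u : u \in X -> color st u = color st x.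
  by move=> /sX; rewrite inE => /eqP.
have nlt v : (color st v == ncolors st) = false.
  by apply/negbTE; rewrite neq_ltn (color_lt I).
have nunk u v : u \in X -> v \notin X -> adj G u v -> (u, v) \in known st.
  move=> uX vX uv; apply: contraR unk => uvK; apply/has_unknownP.
  exists u, v; split=> //; rewrite !inE vX -(Xc _ uX).
  by rewrite (unknown_mono I uv uvK) eqxx.
split=> //=; try by case: I.
- move=> u v uv uvK; case uX: (u \in X); case vX: (v \in X) => //.
  + by move: uvK; rewrite nunk // vX.
  + move: uvK; rewrite (known_sym I) // nunk ?uX // adj_sym //.
  + exact: (unknown_mono I).
- by move=> v; case: ifP => // _; apply: leqW; apply: (color_lt I).
- move=> i; rewrite ltnS leq_eqVlt => /orP[/eqP ->|]; first by exists x; rewrite xX.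
  (* If [X] contained the witness, [y] outside [X] keeps the old color in use. *)
  move=> /(color_surj I)[w <-]; have [wX|wX] := boolP (w \in X).
    exists y; rewrite (negbTE yX) (Xc _ wX).
    by move: yc; rewrite inE => /eqP.
  by exists w; rewrite (negbTE wX).
- move=> C /(fresh_within_le I); apply: leq_trans.
  apply/subset_leq_card/subsetP => -[a b]; rewrite !inE /=.
  move=> /and4P[-> -> ->]; case: ifP => aX; case: ifP => bX //=.
  + by rewrite !Xc.
  + by rewrite eq_sym nlt.
  + by rewrite nlt.
- pose Y := color_class st x :\: X.
  have sub : fresh_across (split_color st X) \subset
      fresh_across st :|: (fresh st :&: setX X Y) :|: (fresh st :&: setX Y X).
    apply/subsetP => -[a b]; rewrite !inE /= => /andP[-> ].
    case: ifP => aX; case: ifP => bX /=; rewrite ?eqxx //= ?andbT ?andbF ?orbF.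
    + by rewrite (Xc _ aX) [in X in _ || X]eq_sym orNb.
    + by rewrite (Xc _ bX) orNb.
    + by [].
  rewrite mulnS addnC [X in _ <= _ + X]mul2n -[X in _ <= _ + X]addnn addnA.
  apply: leq_trans (subset_leq_card sub) _.
  apply: leq_trans (cardsU_le _ _) _; apply: leq_add; last first.
    by rewrite (card_swapI _ _ (fresh_sym I)) ltnW.
  apply: leq_trans (cardsU_le _ _) _; apply: leq_add; last exact: ltnW.
  exact: (fresh_across_le I).
Qed.

(** * Lengths of augmenting paths and the cost of augmentation *)

Lemma invariant_flow_adj (R : realType) (V : finType) (G : sgraph V) (s t : V)
    (k c0 val : nat) (st : state V) :
  state_invariant R G s t k c0 val st -> forall u v, (u, v) \in flow st -> adj G u v.
Proof. by move=> I u v /(flow_touched I)/(touched_known I)/(known_adj I). Qed.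

Lemma fresh_residual (R : realType) (V : finType) (G : sgraph V) (s t : V)
    (k c0 val : nat) (st : state V) :
  state_invariant R G s t k c0 val st ->
  forall u v, (u, v) \in fresh st -> residual st u v.
Proof.
move=> I u v; rewrite inE => /andP[uvT uvK]; rewrite /residual uvK /=.
by apply: contra uvT; apply: (flow_touched I).
Qed.

(** The part of the class of [u] inside [S] is nonempty and proper, hence not deficient. This is
    applied to distance level sets and to the reachable set. *)
Lemma unknown_crossing (R : realType) (V : finType) (G : sgraph V) (s t : V)
    (k c0 val : nat) (st : state V) (S : {set V}) (u v : V) :
  state_invariant R G s t k c0 val st -> (forall x X, ~~ deficient k st x X) ->
  0 < k -> u \in S -> v \notin S -> adj G u v -> (u, v) \notin known st ->
  exists x y, [/\ x \in S, y \notin S, color st x = color st y &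
                  (x, y) \in fresh st].
Proof.
move=> I nodef k0 uS vS uv uvK; pose X := S :&: color_class st u.
have := nodef u X; rewrite /deficient inE uS inE eqxx /=.
rewrite negb_and -leqNgt => /orP[/negP[]|kX].
  apply/properP; split; first exact: subsetIr.
  by exists v; rewrite !inE ?(negbTE vS) // (unknown_mono I uv uvK).
have /card_gt0P[[x y]] := leq_trans k0 kX.
rewrite !inE /= => /and4P[xyF xX yX yc].
case/andP: xX => xS /eqP xc; exists x, y; split=> //.
- by apply: contra yX => yS; rewrite yS yc.
- by rewrite xc (eqP yc).
- by rewrite inE.
Qed.

Lemma leq_window_card (R : realType) (V : finType) (G : sgraph V) (s t : V)
    (k c0 val : nat) (st : state V) (d : V -> nat) (i : nat) :
  state_invariant R G s t k c0 val st -> (forall x X, ~~ deficient k st x X) ->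
  (forall S, is_st_cut s t S -> c0 <= cut_size G S) -> c0 <= #|V| ->
  #|V| <= k ^ 2 -> d s = 0 -> i < d t ->
  (forall u v, residual st u v -> d v <= (d u).+1) ->
  c0 - val <= #|window d i| ^ 2.
Proof.
move=> I nodef c0min c0V Vk ds it dres; pose S := [set v | d v <= i].
have V0 : 0 < #|V| by apply/card_gt0P; exists s.
have k0 : 0 < k by have := leq_trans V0 Vk; rewrite expn_gt0 orbF.
have Scut : is_st_cut s t S by rewrite /is_st_cut !inE ds -ltnNge it.
have dfree u v : (u, v) \in fresh st -> d v <= (d u).+1 /\ d u <= (d v).+1.
  move=> uvF; split; apply: dres; apply: (fresh_residual I) => //.
  exact: (fresh_sym I).
have [/has_unknownP[u [v [uS]]]|nunk] :=
    boolP (has_unknown G (known st) S (~: S)).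
  rewrite inE => vS uv uvK.
  have [x [y [xS yS xyc xyF]]] := unknown_crossing I nodef k0 uS vS uv uvK.
  have [dyx dxy] := dfree _ _ xyF.
  move: xS yS; rewrite !inE -ltnNge => xi yi.
  apply: leq_trans (leq_subr _ _) (leq_trans c0V (leq_trans Vk _)).
  rewrite leq_exp2r //.
  have yx : y != x by apply: contraTneq yi => ->; rewrite -leqNgt.
  (* The singleton of [x] is not deficient, so [x] has [k] fresh neighbours. Fresh arcs are residual
     both ways, which puts these neighbours in the window around layer [i]. *)
  have := nodef x [set x]; rewrite /deficient set11 /= negb_and -leqNgt.
  case/orP=> [/negP[]|].
    apply/properP; split; first by rewrite sub1set inE.
    by exists y; rewrite !inE // xyc.
  move/leq_trans; apply; rewrite -(card_in_imset (f := snd)).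
    apply/subset_leq_card/subsetP => _ /imsetP[[a z] + ->] /=.
    rewrite [_ \in _ :&: _]inE in_setX /= => /andP[azF /andP[]].
    rewrite inE => /eqP ax _; rewrite ax in azF.
    by have := dfree _ _ azF; rewrite inE; lia.
  move=> [a1 b1] [a2 b2]; rewrite !in_setI !in_setX !in_set1 /=.
  by case/and3P=> _ /eqP -> _ /and3P[_ /eqP -> _] ->.
have := cut_excess_le S (invariant_flow_adj I) (flow_antisym I).
rewrite (flow_value I Scut); set E := [set a in _ | _] => cutE.
pose A := [set v | d v == i]; pose B := [set v | d v == i.+1].
(* All of [E] is known and residual, hence runs from layer [i] to layer [i + 1]. Then [c0 - val <=
   2|E| <= 2|A||B| <= (|A| + |B|)^2]. *)
have EAB : #|E| <= #|A| * #|B|.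
  rewrite -cardsX; apply/subset_leq_card/subsetP => -[u v].
  rewrite !inE /= => /andP[/andP[ui vi] /andP[uv uvf]].
  have uvK : (u, v) \in known st.
    by apply: contraR nunk => uvK; apply/has_unknownP; exists u, v; rewrite !inE.
  by have := dres u v; rewrite /residual uvK uvf => /(_ isT); lia.
have ABW : #|A| + #|B| <= #|window d i|.
  rewrite -cardsUI [A :&: B](_ : _ = set0) ?cards0 ?addn0.
    apply/subset_leq_card/subsetP => v; rewrite !inE; lia.
  by apply/setP => v; rewrite !inE; lia.
have cS := c0min _ Scut.
apply: leq_trans (_ : (#|A| + #|B|) ^ 2 <= _); last by rewrite leq_exp2r.
apply: leq_trans (_ : 2 * (#|A| * #|B|) <= _); last first.
  by rewrite sqrnD; exact: leq_addl.
move: EAB cS cutE; rewrite -mul2n; move: #|E| (#|A| * #|B|) (cut_size G S).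
by clear; lia.
Qed.

Lemma shortest_size_le (R : realType) (V : finType) (G : sgraph V) (s t : V)
    (k c0 val : nat) (st : state V) (p : seq V) :
  state_invariant R G s t k c0 val st -> (forall x X, ~~ deficient k st x X) ->
  (forall S, is_st_cut s t S -> c0 <= cut_size G S) -> c0 <= #|V| ->
  #|V| <= k ^ 2 -> shortest (residual st) s t p ->
  ((size p)%:R * Num.sqrt (c0 - val)%:R <= 3 * #|V|%:R :> R)%R.
Proof.
move=> I nodef c0min c0V Vk /exists_potential[d [ds dt dres]].
apply: (@le_trans _ _ (\sum_(i < size p) #|window d i|%:R)%R); last first.
  by rewrite -natr_sum -natrM ler_nat sum_window.
rewrite mulr_natl -[X in (_ *+ X)%R]card_ord -sumr_const.
apply: ler_sum => i _.
have it : i < d t := leq_trans (ltn_ord i) dt.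
rewrite -[leRHS]ger0_norm // -sqrtr_sqr ler_wsqrtr // -natrX ler_nat.
exact: leq_window_card I nodef c0min c0V Vk ds it dres.
Qed.

Lemma path_arcs (T : eqType) (e : rel T) (x : T) (p : seq T) (a : T * T) :
  path e x p -> a \in zip (x :: p) p -> e a.1 a.2.
Proof.
elim: p x => [|y q IH] x //= /andP[xy pq].
by rewrite inE => /orP[/eqP -> //|]; apply: IH.
Qed.

(** Augmenting would give a flow of value [val + 1] along edges of [G], which no s-t cut can be too
    small to carry. *)
Lemma flow_value_lt (R : realType) (V : finType) (G : sgraph V) (s t : V)
    (k c0 val : nat) (st : state V) (p : seq V) (S : {set V}) :
  state_invariant R G s t k c0 val st -> shortest (residual st) s t p ->
  is_st_cut s t S -> val < cut_size G S.
Proof.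
move=> I [pp pt pu _] cutS.
have pf : path (fun u v => (u, v) \notin flow st) s p.
  by apply: sub_path pp => u v /andP[].
have [_ fN fsub] := push_pathP pu pf (flow_antisym I).
have fG u v : (u, v) \in push_path (flow st) s p -> adj G u v.
  case/fsub => [/(invariant_flow_adj I) //|/(path_arcs pp) /andP[]].
  by move=> /(known_adj I).
have := net_flow_le S fG; rewrite fN (flow_value I cutS) pt.
by case/andP: cutS => -> /negbTE ->; lia.
Qed.

Lemma augment_invariant (R : realType) (V : finType) (G : sgraph V) (s t : V)
    (k c0 val : nat) (st : state V) (p : seq V) :
  state_invariant R G s t k c0 val st -> (forall x X, ~~ deficient k st x X) ->
  (forall S, is_st_cut s t S -> c0 <= cut_size G S) -> c0 <= #|V| ->
  #|V| <= k ^ 2 -> val < c0 -> shortest (residual st) s t p ->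
  state_invariant R G s t k c0 val.+1 (augment st s p).
Proof.
move=> I nodef c0min c0V Vk valc0 short.
have [pp pt pu _] := short.
have pf : path (fun u v => (u, v) \notin flow st) s p.
  by apply: sub_path pp => u v /andP[].
have [fA fN fsub] := push_pathP pu pf (flow_antisym I).
have arcsK a : a \in zip (s :: p) p -> a \in known st.
  by move=> /(path_arcs pp) /andP[]; case: a.
have swapP (z : seq (V * V)) u v : ((u, v) \in map swap_pair z) = ((v, u) \in z).
  by rewrite -[(u, v)]/(swap_pair (v, u)) mem_map //; apply: can_inj swap_pairK.
have freeS a : a \in fresh (augment st s p) -> a \in fresh st.
  by rewrite !inE !negb_or => /andP[/andP[/andP[-> _] _] ->].
split=> //=; try by case: I.
- move=> u v; rewrite !inE swapP => /orP[/orP[/(touched_known I)|/arcsK]|/arcsK] //.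
  by move/(known_sym I).
- move=> u v; rewrite !inE !swapP => /orP[/orP[/(touched_sym I)|]|] ->;
    by rewrite ?orbT.
- by move=> u v /fsub[/(flow_touched I)|]; rewrite !inE => ->; rewrite ?orbT.
- move=> C /(fresh_within_le I); apply: leq_trans.
  apply/subset_leq_card/subsetP => a; rewrite inE => /andP[/freeS aF aC].
  by rewrite inE aF.
- apply: leq_trans (fresh_across_le I).
  apply/subset_leq_card/subsetP => a; rewrite inE => /andP[/freeS aF aC].
  by rewrite inE aF.
- move=> S cutS; rewrite fN (flow_value I cutS) pt.
  by case/andP: cutS => -> /negbTE ->; lia.
have := shortest_size_le I nodef c0min c0V Vk short.
have := touched_le I.
have : #|touched st :|: [set a in zip (s :: p) p]
         :|: [set a in map swap_pair (zip (s :: p) p)]|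
       <= #|touched st| + (size p).*2.
  have zs : size (zip (s :: p) p) = size p by rewrite size_zip /= minnE subSnn subn1.
  rewrite -addnn addnA; apply: leq_trans (cardsU_le _ _) _; apply: leq_add.
    apply: leq_trans (cardsU_le _ _) _; rewrite leq_add2l cardsE.
    by apply: leq_trans (card_size _) _; rewrite zs.
  by rewrite cardsE; apply: leq_trans (card_size _) _; rewrite size_map zs.
rewrite -(ler_nat R); set T' := #|_ :|: _|; rewrite natrD -mul2n natrM.
have -> : c0 - val = (c0 - val.+1).+1 by lia.
move: (c0 - val.+1) => r.
set a := (Num.sqrt r.+1%:R)%R; set b := (Num.sqrt r%:R)%R.
have a2 : (a ^+ 2 = r%:R + 1)%R by rewrite sqr_sqrtr // -natr1.
have b2 : (b ^+ 2 = r%:R)%R by rewrite sqr_sqrtr.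
have a0 : (0 < a)%R by rewrite sqrtr_gt0 ltr0n.
have b0 : (0 <= b)%R by exact: sqrtr_ge0.
have ab : (b <= a)%R by rewrite ler_wsqrtr // ler_nat.
move: a b a2 b2 a0 b0 ab => a b a2 b2 a0 b0 ab T'le Tle Dle.
have D0 : (0 <= (size p)%:R :> R)%R by [].
(* Here [(a - b)(a + b) = 1] and [a + b <= 2a], while [size p * a <= 3n]. Each path edge touches two
   arcs, which turns 6 into 12. *)
have : ((size p)%:R <= 6 * #|V|%:R * (a - b) :> R)%R.
  rewrite -(@ler_pM2r _ (a + b)%R); last by rewrite ltr_wpDr.
  have -> : (6 * #|V|%:R * (a - b) * (a + b) = 6 * #|V|%:R :> R)%R.
    by rewrite -mulrA -subr_sqr a2 b2; ring.
  nra.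
move: T'le Tle; move: T'%:R%R => T''; lra.
Qed.

(** * Termination and correctness of the search *)

(** The constant is 12 for touched arcs, 2 each for fresh arcs within and across classes, and 1 for
    the colors. *)
Lemma state_size_le (R : realType) (V : finType) (G : sgraph V) (s t : V)
    (k c0 val : nat) (st : state V) :
  state_invariant R G s t k c0 val st -> c0 <= #|V| -> #|V| <= k ^ 2 ->
  #|known st| + ncolors st <= 17 * #|V| * k.
Proof.
move=> I c0V Vk.
have V0 : 0 < #|V| by apply/card_gt0P; exists s.
have k0 : 0 < k by have := leq_trans V0 Vk; rewrite expn_gt0 orbF.
have ncV : ncolors st <= #|V|.
  have /choice[f fP] : forall i : 'I_(ncolors st), exists v, color st v = i.
    by move=> i; apply: (color_surj I).
  rewrite -[ncolors st]card_ord; apply: (@leq_card _ _ f) => i j fij.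
  by apply: ord_inj; rewrite -(fP i) -(fP j) fij.
have touchedV : #|touched st| <= 12 * #|V| * k.
  rewrite -(ler_nat R); apply: le_trans (touched_le I) _.
  rewrite [leRHS]natrM [X in (_ <= X * _)%R]natrM ler_wpM2l //.
  rewrite lerBlDr; apply: ler_wpDr; first exact: sqrtr_ge0.
  rewrite -[leRHS]ger0_norm // -sqrtr_sqr ler_wsqrtr // -natrX ler_nat.
  exact: leq_trans Vk.
have VT0 : [set: V] != set0 by apply/set0Pn; exists s; rewrite inE.
have sub : known st \subset fresh_within st [set: V] :|: fresh_across st :|: touched st.
  apply/subsetP => a aK; rewrite !inE aK /= andbT.
  by case: (a \in touched st); case: (_ == _).
have w := fresh_within_le I VT0; rewrite cardsT in w.
have ac := fresh_across_le I.
have h1 := leq_trans (subset_leq_card sub) (cardsU_le _ _).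
have h2 := cardsU_le (fresh_within st [set: V]) (fresh_across st).
have w' : 2 * k * #|V|.-1 <= 2 * k * #|V| by rewrite leq_mul2l leq_pred orbT.
have ac' : 2 * k * ncolors st <= 2 * k * #|V| by rewrite leq_mul2l ncV orbT.
have Vk1 : #|V| <= #|V| * k by rewrite leq_pmulr.
move: touchedV w ac h1 h2 w' ac' Vk1 ncV.
rewrite [2 * k * #|V|]mulnC -!mulnA ![12 * _]mulnA.
move: #|known st| #|touched st| #|fresh_within _ _| #|fresh_across _| #|_ :|: _|.
by clear; nia.
Qed.

(** Each round raises [#|known st| + ncolors st + val], so enough fuel makes the final [set0]
    unreachable. Deficient sets and shortest paths are chosen noncomputably, as local computation is
    free. *)
Fixpoint search (V : finType) (s t : V) (k fuel : nat) (st : state V) :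
    cut_algo V {set V} :=
  if fuel is fuel'.+1 then
    match [pick z : V * {set V} | deficient k st z.1 z.2] with
    | Some (x, X) =>
      bind (find_unknown x (known st) X (color_class st x :\: X)) (fun o =>
        if o is Some (u, v) then search s t k fuel' (add_edge st u v)
        else search s t k fuel' (split_color st X))
    | None =>
      match pselect (exists p, shortest (residual st) s t p) with
      | left ex => search s t k fuel' (augment st s (sval (cid ex)))
      | right _ => Return V [set v | connect (residual st) s v]
      end
    end
  else Return V set0.

Lemma reachable_min_cut (R : realType) (V : finType) (G : sgraph V) (s t : V)
    (k c0 val : nat) (st : state V) :
  state_invariant R G s t k c0 val st -> (forall x X, ~~ deficient k st x X) ->
  0 < k -> ~~ connect (residual st) s t ->
  is_min_st_cut G s t [set v | connect (residual st) s v].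
Proof.
move=> I nodef k0 nst; set S := [set v | _].
have cutS : is_st_cut s t S by rewrite /is_st_cut !inE connect0.
have resS u v : u \in S -> residual st u v -> v \in S.
  by rewrite !inE => su uv; apply: connect_trans su (connect1 uv).
rewrite /is_min_st_cut cutS; apply/forallP => S'; apply/implyP => cutS'.
have := cut_excess_le S (invariant_flow_adj I) (flow_antisym I).
have := net_flow_le S' (invariant_flow_adj I).
rewrite (flow_value I cutS) (flow_value I cutS').
set E := [set a in _ | _]; have -> : E = set0; last by rewrite cards0; lia.
apply/setP => -[u v]; rewrite in_set0; apply/negbTE.
rewrite in_set in_setX in_setC /=; apply/negP.
move=> /andP[/andP[uS vS] /andP[uv uvf]].
have [uvK|uvK] := boolP ((u, v) \in known st).
  by rewrite (resS u v) // /residual uvK in vS.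
have [x [y [xS yS _ xyF]]] := unknown_crossing I nodef k0 uS vS uv uvK.
by rewrite (resS x y) // in yS; apply: (fresh_residual I).
Qed.

Lemma searchP (R : realType) (V : finType) (G : sgraph V) (s t : V)
    (k c0 val fuel : nat) (st : state V) :
  state_invariant R G s t k c0 val st ->
  (forall S, is_st_cut s t S -> c0 <= cut_size G S) ->
  (exists2 S, is_st_cut s t S & cut_size G S = c0) -> c0 <= #|V| ->
  #|V| <= k ^ 2 ->
  17 * #|V| * k + #|V| < fuel + (#|known st| + ncolors st + val) ->
  ensures G (fuel * find_cost V) (search s t k fuel st) (is_min_st_cut G s t).
Proof.
move=> + c0min [Smin cutSmin Smin0] c0V Vk.
have val_le val' st' : state_invariant R G s t k c0 val' st' -> val' <= c0.
  move=> I; have := net_flow_le Smin (invariant_flow_adj I).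
  by rewrite (flow_value I cutSmin) Smin0.
have V0 : 0 < #|V| by apply/card_gt0P; exists s.
have k0 : 0 < k by have := leq_trans V0 Vk; rewrite expn_gt0 orbF.
elim: fuel val st => [|fuel IH] val st I bound.
  (* Without fuel the measure would exceed its maximum [17nk + n], where [n] bounds the flow
     value. *)
  have := state_size_le I c0V Vk; have := val_le _ _ I; move: bound c0V.
  by move: #|V| #|known st| (17 * #|V| * k); clear; lia.
rewrite mulSn; cbn [search]; case: pickP => [[x X] /= def|nodef].
  have dis : [disjoint X & color_class st x :\: X].
    by rewrite -setI_eq0 setIDA setIC setDIl setDv setI0.
  refine (ensures_bind (find_unknownP x (known_adj I) (known_sym I) dis) _).
  case=> [[u v] [uX vY uv uvK]|unk].
    have [I' lt] := add_edge_invariant I def uX vY uv uvK.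
    apply: IH I' _; apply: leq_trans bound _; rewrite addSnnS leq_add2l.
    by rewrite -!addSn !leq_add2r.
  apply: IH (split_color_invariant I def unk) _.
  by apply: leq_trans bound _; rewrite /= !(addSn, addnS).
have {}nodef x X : ~~ deficient k st x X by rewrite (nodef (x, X)).
case: pselect => [ex|nex]; last first.
  apply: (reachable_min_cut I nodef k0); apply/negP => /connect_shortest.
  exact: nex.
apply: ensures_weaken (_ : fuel * _ <= _) _ (IH val.+1 _ _ _) => //.
- exact: leq_addl.
- case: (cid ex) => p /= short.
  apply: (augment_invariant I nodef c0min c0V Vk _ short).
  by have := flow_value_lt I short cutSmin; rewrite Smin0.
- by apply: leq_trans bound _; rewrite /= !(addSn, addnS).
Qed.

(** * Choice of parameters and the final bound *)

Lemma min_cut_size_exists (V : finType) (G : sgraph V) (s t : V) :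
  s != t -> exists c0, [/\ c0 <= #|V|,
    forall S, is_st_cut s t S -> c0 <= cut_size G S &
    exists2 S, is_st_cut s t S & cut_size G S = c0].
Proof.
move=> st; have cut1 : is_st_cut s t [set s].
  by rewrite /is_st_cut !inE eqxx eq_sym.
case: (arg_minnP (cut_size G) cut1) => S cutS Smin.
exists (cut_size G S); split=> //; last by exists S.
apply: leq_trans (Smin _ cut1) _.
apply: (@leq_trans #|setX [set s] [set: V]|).
  by apply/subset_leq_card/subsetP => -[u v]; rewrite !inE /= => /andP[->].
by rewrite cardsX cards1 mul1n cardsT.
Qed.

Lemma sqrt_up_exists (n : nat) :
  exists2 k, n <= k ^ 2 & k ^ 2 <= 4 * n.
Proof.
have exP : exists k, n <= k ^ 2 by exists n; rewrite -mulnn; case: n => // n; nia.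
case: (ex_minnP exP) => k nk kmin; exists k => //.
case: k nk kmin => // k _ kmin.
(* The least root is now [k + 1], and [(k + 1)^2 <= 4k^2] once [k] is positive. *)
have : k ^ 2 < n by rewrite ltnNge; apply/negP => /kmin; rewrite ltnn.
rewrite -!mulnn; case: k {kmin} => [|k]; nia.
Qed.

Lemma find_cost_le (V : finType) :
  1 < #|V| -> find_cost V <= 15 * trunc_log 2 #|V|.
Proof.
move=> V1; have tl1 : 0 < trunc_log 2 #|V| by rewrite trunc_log_gt0.
have : up_log 2 #|V| <= (trunc_log 2 #|V|).+1.
  by apply: up_log_min => //; apply/ltnW/trunc_log_ltn.
rewrite /find_cost; move: (up_log _ _) (trunc_log _ _) tl1; clear; lia.
Qed.

Local Open Scope ring_scope.

Lemma trunc_log2_le (R : realType) (n : nat) :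
  (0 < n)%N -> (trunc_log 2 n)%:R * ln 2 <= ln n%:R :> R.
Proof.
move=> n0; rewrite mulr_natl -lnXn // -natrX ler_ln ?posrE ?ltr0n ?expn_gt0 //.
by rewrite ler_nat trunc_logP.
Qed.

Theorem mainTheorem1 (R : realType) (c : nat) :
  exists (A : forall V : finType, V -> V -> cut_algo V {set V})
         (C : R) (k : nat),
  forall (V : finType) (s t : V) (G : sgraph V), s != t ->
    (max_queries G (A V s t))%:R
      <= C * (#|V|%:R `^ (8 / 5)) * (ln #|V|%:R) ^+ k
    /\ 1 - (#|V|%:R ^+ c)^-1
         <= prob_output R G (is_min_st_cut G s t) (A V s t).
Proof.
pose root n := sval (cid2 (sqrt_up_exists n)).
have rootP n : (n <= root n ^ 2 /\ root n ^ 2 <= 4 * n)%N.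
  by rewrite /root; case: cid2.
pose steps (V : finType) := (17 * #|V| * root #|V| + #|V|)%N.
exists (fun (V : finType) (s t : V) => search s t (root #|V|) (steps V)
  (State set0 set0 set0 (fun=> 0%N) 1)).
(* The factor 18 comes from [17nk + n <= 18nk], 2 from [k <= 2 sqrt n], 15 from [find_cost_le], and
   [ln 2] from the change of logarithm base. *)
exists (18 * 2 * 15 / ln 2), 1%N => V s t G st.
have V1 : (1 < #|V|)%N by apply/card_gt1P; exists s, t.
have [c0 [c0V c0min c0S]] := min_cut_size_exists G st.
have [rootV root4V] := rootP #|V|.
have ens := searchP (init_invariant R G s t (root #|V|) c0) c0min c0S c0V rootV
  (_ : _ < steps V + _)%N.
(* The single initial color already makes the measure 1, which gives the strict inequality. *)
have {ens} := ens _; rewrite cards0 addnA addn0 addn1 => /(_ (ltnSn _)) ens.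
split; last first.
  rewrite (ensures_prob_output R ens) lerBlDr lerDl invr_ge0.
  by rewrite exprn_ge0.
have n0 : 0 < #|V|%:R :> R by rewrite ltr0n ltnW.
have ln2 : 0 < ln 2 :> R by rewrite ln_gt0 // ltr1n.
have logV : (trunc_log 2 #|V|)%:R <= ln #|V|%:R / ln 2 :> R.
  by rewrite ler_pdivlMr // trunc_log2_le // ltnW.
have rootR : (root #|V|)%:R <= 2 * #|V|%:R `^ (2^-1) :> R.
  rewrite powR12_sqrt ?ler0n // -(ler_pXn2r (ltn0Sn 1)) ?nnegrE //.
    by rewrite exprMn sqr_sqrtr // -!natrX -natrM ler_nat.
(* The exponent [3/2] obtained is below the [8/5] required. *)
have powV : #|V|%:R * #|V|%:R `^ (2^-1) <= #|V|%:R `^ (8 / 5) :> R.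
  rewrite -{1}[#|V|%:R]powRr1 ?ler0n // -powRD; last by rewrite gt_eqF ?implybT.
  by rewrite ler_powR ?ler1n ?(ltnW V1) //; lra.
apply: (@le_trans _ _ (steps V * find_cost V)%:R).
  by rewrite ler_nat (ensures_max_queries ens).
apply: (@le_trans _ _ ((18 * #|V| * root #|V|) * (15 * trunc_log 2 #|V|))%:R).
  rewrite ler_nat leq_mul ?find_cost_le // /steps.
  have : (0 < root #|V|)%N.
    by have := leq_trans (ltnW V1) rootV; rewrite expn_gt0 orbF.
  by move: #|V| (root _); clear; nia.
rewrite expr1 !natrM.
have := ler_pM _ _ powV logV; rewrite mulr_ge0 ?powR_ge0 ?ler0n // => /(_ isT isT).
set L := (trunc_log _ _)%:R; set P := _ `^ (8 / 5); set q := _ `^ _.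
move=> PL; apply: (@le_trans _ _ (18 * 2 * 15 * (#|V|%:R * q * L))).
  have L0 : 0 <= L by rewrite ler0n.
  have : (root #|V|)%:R * (#|V|%:R * L) <= 2 * q * (#|V|%:R * L).
    by rewrite ler_wpM2r // mulr_ge0 // ltW.
  by lra.
have -> : 18 * 2 * 15 / ln 2 * P * ln #|V|%:R =
          18 * 2 * 15 * (P * (ln #|V|%:R / ln 2)) by ring.
by rewrite ler_wpM2l.
Qed.
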